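(* Let $\lambda:[0,\infty)\to[0,\infty)$ be continuous, let $\Lambda(t)=\int_0^t\lambda(u)\,du$ for $t\ge 0$, and let $k\ge 1$ be an integer. Let $T_k$ be a random variable with probability density function $$f_k(t)=\begin{cases}\dfrac{\lambda(t)}{(k-1)!}\,\Lambda(t)^{k-1}\exp(-\Lambda(t)), & t\ge 0,\\[1ex] 0, & t<0.\end{cases}$$ Suppose that $\lim_{t\to\infty}\lambda(t)=m$ exists, where $m$ is a strictly positive real constant. Then the limit CDF of $T_k$ is $$G(h)=1-\exp(-mh),\qquad h\ge 0,$$ where $m$ does not depend on $k$. That is, for every $h\ge 0$, $\lim_{t\to\infty}\mathbb{P}(t<T_k\le t+h\mid T_k>t)=1-\exp(-mh)$.
   Context: For a random variable $T$ put $F_t(h)=\mathbb{P}(t<T\le t+h\mid T>t)$. The limit CDF of $T$ is the cumulative distribution function $G$ satisfying $G(h)=\lim_{t\to\infty}F_t(h)$, when it exists. The random variable $T_k$ is the $k$-th jump time of a non-homogeneous Poisson process on $[0,\infty)$ with intensity function $\lambda$ and cumulative intensity function $\Lambda$; its density is $f_k$. *)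

(* Defs.v *)
From HB Require Import structures.
From mathcomp Require Export all_boot all_order all_algebra.
From mathcomp Require Export all_classical all_reals all_analysis.
Export Order.TTheory GRing.Theory Num.Theory.
Export numFieldNormedType.Exports.

Set Implicit Arguments.
Unset Strict Implicit.
Unset Printing Implicit Defensive.

Local Open Scope classical_set_scope.
Local Open Scope ring_scope.

(* Elementary conditional probability P(A | B); the total division makes it 0
   when P(B) = 0. *)
Definition cond_prob (d : measure_display) (Om : measurableType d)
    (R : realType) (P : probability Om R) (A B : set Om) : R :=
  fine (P (A `&` B)) / fine (P B).

Definition excess_cdf (d : measure_display) (Om : measurableType d)
    (R : realType) (P : probability Om R) (T : {RV P >-> R}) (t h : R) : R :=
  cond_prob P [set w | t < T w <= t + h] [set w | t < T w].

Definition is_cdf (R : realType) (G : R -> R) : Prop :=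
  [/\ {homo G : x y / x <= y},
      right_continuous G,
      G x @[x --> -oo] --> (0 : R) &
      G x @[x --> +oo] --> (1 : R)].

(* If P(T > t) = 0 for some t, then excess_cdf vanishes for all larger t, so
   the convention on cond_prob cannot produce a limit that is a CDF. *)
Definition is_limit_cdf (d : measure_display) (Om : measurableType d)
    (R : realType) (P : probability Om R) (T : {RV P >-> R})
    (G : R -> R) : Prop :=
  is_cdf G /\ forall h : R, excess_cdf T t h @[t --> +oo] --> G h.

Definition has_pdf (d : measure_display) (Om : measurableType d)
    (R : realType) (P : probability Om R) (T : {RV P >-> R})
    (f : R -> R) : Prop :=
  [/\ measurable_fun [set: R] f,
      forall x, 0 <= f x &
      forall A : set R, measurable A ->
        distribution P T A = (\int[lebesgue_measure]_(x in A) (f x)%:E)%E].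

(* Intended for t >= 0, where it is the integral of lam from 0 to t. *)
Definition cumulative_intensity (R : realType) (lam : R -> R) (t : R) : R :=
  \int[lebesgue_measure]_(u in `[0, t]) lam u.

Definition jump_time_pdf (R : realType) (lam : R -> R) (k : nat) (t : R) : R :=
  if 0 <= t then
    lam t / (k.-1)`!%:R * cumulative_intensity lam t ^+ k.-1
      * expR (- cumulative_intensity lam t)
  else 0.

(* Main.v *)
Require Import Defs.
From mathcomp Require Import ring lra.

(** The survival function of the k-th jump time is explicit: the derivative of
    exp(-x) * \sum_(j < k) x^j / j! telescopes to -(x^(k-1) / (k-1)!) exp(-x),
    so by the chain rule t |-> -(this function at Lambda t) is a primitive of
    the density (jump_time_pdf_integral). It equals -1 at t = 0, whence
    P(T_k > t) = exp(-Lambda t) Q(Lambda t), with Q the truncated exponential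
    series (ccdf_jump_time). Integrating over [0, t] and taking complements
    avoids any improper integral.

    The conditional probability is one minus the ratio
    P(T_k > t + h) / P(T_k > t), a product of two factors.
    - exp(-(Lambda (t + h) - Lambda t)): by the mean value theorem the increment
      is h times a value of the intensity beyond t, so it tends to m h
      (cumulative_intensity_increment_cvg). This factor gives the limit.
    - Q(Lambda (t + h)) / Q(Lambda t): since Q has degree k - 1 and nonnegative
      coefficients, this lies between 1 and (Lambda (t + h) / Lambda t)^(k-1).
      As m > 0, Lambda tends to infinity while its increments stay bounded, so
      the upper bound tends to 1 (exp_trunc_ratio_cvg). This is why k disappears
      in the limit. *)

Set Implicit Arguments.
Unset Strict Implicit.

Local Open Scope classical_set_scope.
Local Open Scope ring_scope.

(** * Truncated exponential series and the Erlang tail *)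

Definition exp_trunc {R : realType} (k : nat) (x : R) : R :=
  \sum_(j < k) x ^+ j / j`!%:R.

(** The probability that a Poisson variable of mean x is less than k, or that a
    sum of k independent unit exponential variables exceeds x. *)
Definition erlang_tail {R : realType} (k : nat) (x : R) : R :=
  expR (- x) * exp_trunc k x.

Lemma exp_truncS (R : realType) k (x : R) :
  exp_trunc k.+1 x = exp_trunc k x + x ^+ k / k`!%:R.
Proof. by rewrite /exp_trunc big_ord_recr. Qed.

Lemma exp_trunc1 (R : realType) (x : R) : exp_trunc 1 x = 1.
Proof. by rewrite /exp_trunc big_ord1 expr0 fact0 divr1. Qed.

Lemma exp_trunc_gt0 (R : realType) k (x : R) : 0 <= x -> 0 < exp_trunc k.+1 x.
Proof.
move=> x0; elim: k => [|k IH]; first by rewrite exp_trunc1.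
by rewrite exp_truncS ltr_wpDr// divr_ge0// exprn_ge0.
Qed.

Lemma erlang_tail_gt0 (R : realType) k (x : R) : 0 <= x ->
  0 < erlang_tail k.+1 x.
Proof. by move=> x0; rewrite mulr_gt0 ?expR_gt0 ?exp_trunc_gt0. Qed.

Lemma exp_trunc_le (R : realType) k (x y : R) : 0 <= x -> x <= y ->
  exp_trunc k x <= exp_trunc k y.
Proof.
move=> x0 xy; apply: ler_sum => j _.
by rewrite ler_wpM2r ?invr_ge0// lerXn2r// nnegrE (le_trans x0).
Qed.

(** The series is cut at degree k, so a factor c >= 1 multiplies each monomial
    by at most c ^+ k. *)
Lemma exp_trunc_scale_le (R : realType) k (c x : R) : 1 <= c -> 0 <= x ->
  exp_trunc k.+1 (c * x) <= c ^+ k * exp_trunc k.+1 x.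
Proof.
move=> c1 x0; rewrite /exp_trunc mulr_sumr; apply: ler_sum => j _.
rewrite exprMn -mulrA ler_wpM2r//; first by rewrite divr_ge0// exprn_ge0.
by rewrite ler_weXn2l// -ltnS.
Qed.

Lemma erlang_tail0 (R : realType) k : erlang_tail k.+1 (0 : R) = 1.
Proof.
rewrite /erlang_tail oppr0 expR0 mul1r /exp_trunc big_ord_recl/=.
rewrite expr0 fact0 divr1.
by rewrite big1 ?addr0// => j _; rewrite expr0n mul0r.
Qed.

(** Each summand x^j / j! exp(-x) has derivative
    x^(j-1) / (j-1)! exp(-x) - x^j / j! exp(-x): the sum telescopes and only the
    last negative term survives. *)
Lemma is_derive_erlang_tail {R : realType} k (x : R) :
  is_derive x 1 (erlang_tail k.+1) (- (x ^+ k / k`!%:R * expR (- x))).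
Proof.
have dE : is_derive x 1 (fun y : R => expR (- y)) (- expR (- x)).
  apply: is_derive_eq.
  by rewrite mulrN1.
elim: k => [|k IH].
  have -> : erlang_tail 1 = fun y : R => expR (- y).
    by apply/funext => y; rewrite /erlang_tail exp_trunc1 mulr1.
  by rewrite expr0 fact0 divr1 mul1r.
have -> : erlang_tail k.+2 = erlang_tail k.+1 +
    ((fun y : R => expR (- y)) * (cst k.+1`!%:R^-1 * (@id R ^+ k.+1))).
  apply/funext => y; rewrite /erlang_tail exp_truncS mulrDr /=.
  by rewrite !fctE [_^-1 * _]mulrC.
apply: is_derive_eq.
rewrite !fctE /= scaler0 addr0 /GRing.scale/= mulr1.
have -> : (k.+1)`!%:R^-1 * (k.+1%:R * x ^+ k) = x ^+ k / k`!%:R :> R.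
  by rewrite factS natrM; field; rewrite nat1r !pnatr_eq0 -lt0n fact_gt0.
by ring.
Qed.

Lemma continuous_erlang_tail (R : realType) k :
  continuous (@erlang_tail R k.+1).
Proof.
by move=> x; apply/differentiable_continuous/derivable1_diffP;
  case: (is_derive_erlang_tail k x).
Qed.

(** * Cumulative intensity *)

Section cumulative.
Context {R : realType} (lam : R -> R).
Hypothesis lam_cont : {within `[0, +oo[, continuous lam}.
Let L := cumulative_intensity lam.

Lemma intensity_continuous_segment b : {within `[0, b], continuous lam}.
Proof.
apply: continuous_subspaceW lam_cont => x /=.
by rewrite !in_itv/= => /andP[-> _].
Qed.

Lemma intensity_integrable_segment b :
  lebesgue_measure.-integrable `[0, b] (EFin \o lam).
Proof.
by apply: continuous_compact_integrable;
  [exact: segment_compact|exact: intensity_continuous_segment].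
Qed.

Lemma is_derive_cumulative_intensity (x : R) : 0 < x -> is_derive x 1 L (lam x).
Proof.
move=> x0.
have lamx : {for x, continuous lam}.
  move/continuous_within_itvcyP : lam_cont => [+ _]; apply.
  by rewrite in_itv/= x0.
have x1 : x < x + 1 by rewrite ltrDl.
have [dL <-] := continuous_FTC1_closed x1
  (intensity_integrable_segment (x + 1)) x0 lamx.
by rewrite derive1E; exact: derivableP.
Qed.

Lemma within_continuous_cumulative_intensity b : {within `[0, b], continuous L}.
Proof.
have [b0|b0] := leP 0 b; first exact:
  parameterized_integral_continuous (intensity_integrable_segment b).
by rewrite set_itv_ge ?bnd_simp -?ltNge//; exact: continuous_subspace0.
Qed.

Lemma cumulative_intensity0 : L 0 = 0.
Proof. by rewrite /L/cumulative_intensity set_itv1 Rintegral_set1. Qed.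

(** Turns information on the intensity near infinity into information on the
    increments of its integral. *)
Lemma cumulative_intensity_MVT a b : 0 <= a -> a <= b ->
  exists2 c, c \in `[a, b] & L b - L a = lam c * (b - a).
Proof.
move=> a0 ab; apply: MVT_segment => // [x|].
  by rewrite in_itv/= => /andP[ax _]; apply: is_derive_cumulative_intensity;
    exact: le_lt_trans ax.
apply: continuous_subspaceW (@within_continuous_cumulative_intensity b) => x /=.
by rewrite !in_itv/= => /andP[ax ->]; rewrite (le_trans a0).
Qed.
End cumulative.

(** * Survival function of the jump time *)

Section survival.
Context {R : realType} (lam : R -> R).
Hypothesis lam_cont : {within `[0, +oo[, continuous lam}.
Hypothesis lam_ge0 : forall t, 0 <= t -> 0 <= lam t.
Let L := cumulative_intensity lam.

Lemma cumulative_intensity_ge0 t : 0 <= L t.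
Proof.
apply: Rintegral_ge0 => x /=; rewrite in_itv/= => /andP[x0 _]; exact: lam_ge0.
Qed.

(** The density is, on [0, t], the derivative of minus the Erlang tail composed
    with the cumulative intensity, so this is the fundamental theorem of
    calculus. *)
Lemma jump_time_pdf_integral k t : 0 <= t ->
  (\int[lebesgue_measure]_(x in `[0%R, t])
    (jump_time_pdf lam k.+1 x)%:E)%E = (1 - erlang_tail k.+1 (L t))%:E.
Proof.
rewrite le_eqVlt => /predU1P[<-|t0].
  rewrite set_itv1 integral_set1 /L (cumulative_intensity0 lam).
  by rewrite erlang_tail0 subrr.
pose g x := lam x / k`!%:R * L x ^+ k * expR (- L x).
have -> : (\int[lebesgue_measure]_(x in `[0%R, t])
    (jump_time_pdf lam k.+1 x)%:E)%E =
  (\int[lebesgue_measure]_(x in `[0%R, t]) (g x)%:E)%E.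
  apply: eq_integral => x; rewrite inE/= in_itv/= => /andP[x0 _].
  by rewrite /jump_time_pdf x0.
have cL : {within `[0, t], continuous L}.
  exact: within_continuous_cumulative_intensity.
have cLx (x : subspace `[0, t]) :
    (L : subspace `[0, t] -> R) y @[y --> x] --> L x.
  exact: cL.
have cE : {within `[0, t], continuous (fun x => - erlang_tail k.+1 (L x))}.
  move=> x; apply: cvgN; apply: continuous_cvg (cLx x).
  exact: continuous_erlang_tail.
have dE (x : R) : 0 < x ->
    is_derive x 1 (fun x => - erlang_tail k.+1 (L x)) (g x).
  move=> x0.
  have dS := is_derive1_comp (is_derive_erlang_tail k (L x))
    (is_derive_cumulative_intensity lam_cont x0).
  have dN := is_deriveN dS.
  apply: is_derive_eq dN _.
  by rewrite /g; ring.
have [_ E0 Et] := (continuous_within_itvP _ t0).1 cE.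
rewrite (@continuous_FTC2 _ g (fun x => - erlang_tail k.+1 (L x))) //.
- by rewrite /L (cumulative_intensity0 lam) erlang_tail0 -EFinB opprK addrC.
- move=> x; apply: cvgM; [apply: cvgM; [apply: cvgM|]|].
  + exact: (intensity_continuous_segment lam_cont).
  + exact: cvg_cst.
  + exact: (continuous_cvg _ (@exprn_continuous R k (L x)) (cLx x)).
  + exact: (continuous_cvg _ (@continuous_expR R _) (cvgN (cLx x))).
- by split => // x /[!in_itv]/= /andP[x0 _]; case: (dE x x0).
- move=> x /[!in_itv]/= /andP[x0 _]; rewrite derive1E.
  exact: (@derive_val _ _ _ _ _ _ _ (dE x x0)).
Qed.

Lemma ccdf_jump_time d (Om : measurableType d) (P : probability Om R)
    (T : {RV P >-> R}) k t : has_pdf T (jump_time_pdf lam k.+1) -> 0 <= t ->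
  ccdf T t = (erlang_tail k.+1 (L t))%:E.
Proof.
move=> [_ _ TE] t0; rewrite ccdf_1_cdf /cdf TE; last exact: measurable_itv.
(* The density vanishes on the negative half-line. *)
suff -> : (\int[lebesgue_measure]_(x in `]-oo, t])
    (jump_time_pdf lam k.+1 x)%:E =
  \int[lebesgue_measure]_(x in `[0%R, t]) (jump_time_pdf lam k.+1 x)%:E)%E.
  by rewrite jump_time_pdf_integral// -EFinB opprB addrC subrK.
rewrite integral_mkcond [RHS]integral_mkcond; apply: eq_integral => x _.
rewrite !patchE !mem_setE !in_itv/=; have [//|x0] := leP 0 x.
have -> : jump_time_pdf lam k.+1 x = 0 by rewrite /jump_time_pdf leNgt x0.
by case: ifP.
Qed.
End survival.

(** * Asymptotics under a convergent intensity *)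

Section limits.
Context {R : realType} (lam : R -> R) (m : R).
Hypothesis lam_cont : {within `[0, +oo[, continuous lam}.
Hypothesis lam_ge0 : forall t, 0 <= t -> 0 <= lam t.
Hypothesis m_gt0 : 0 < m.
Hypothesis lam_lim : lam t @[t --> +oo] --> m.
Let L := cumulative_intensity lam.

(** On [t, t + h] the mean value theorem yields lam c * h with c >= t, and c
    goes to infinity with t. *)
Lemma cumulative_intensity_increment_cvg h : 0 <= h ->
  L (t + h) - L t @[t --> +oo] --> m * h.
Proof.
move=> h0; apply/cvgrPdist_le => e e0.
(* Dividing by h + 1 rather than h covers h = 0. *)
have h1 : 0 < h + 1 by rewrite ltr_wpDl.
have /cvgrPdist_le/(_ _ (divr_gt0 e0 h1)) := lam_lim.
move=> [M [_ HM]].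
near=> t.
have t0 : 0 <= t by near: t; apply: nbhs_pinfty_ge; exact: num_real.
have th : t <= t + h by rewrite lerDl.
have [c /[!in_itv]/= /andP[tc _] ->] := cumulative_intensity_MVT lam_cont t0 th.
have tM : M < t by near: t; apply: nbhs_pinfty_gt; exact: num_real.
have := HM c (lt_le_trans tM tc) => /= cE.
rewrite addrAC subrr add0r -mulrBl normrM (ger0_norm h0).
apply: le_trans (ler_wpM2r h0 cE) _.
by rewrite -mulrA ler_piMr ?(ltW e0)// mulrC ler_pdivrMr// mul1r lerDl.
Unshelve. all: by end_near. Qed.

(** The intensity eventually exceeds m / 2 > 0, so its integral grows at least
    linearly. *)
Lemma cumulative_intensity_cvgy : L t @[t --> +oo] --> +oo.
Proof.
have m2 : 0 < m / 2 by rewrite divr_gt0.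
have /cvgrPdist_le/(_ _ m2) := lam_lim.
move=> [M [_ HM]].
pose a := Num.max M 0 + 1.
have a0 : 0 <= a by rewrite addr_ge0// le_max lexx orbT.
have Ma : M < a by rewrite ltr_pwDr// le_max lexx.
apply/cvgryPge => A; near=> t.
have ta : a <= t by near: t; apply: nbhs_pinfty_ge; exact: num_real.
have tA : a + A / (m / 2) <= t.
  by near: t; apply: nbhs_pinfty_ge; exact: num_real.
have [c /[!in_itv]/= /andP[ac _] LE] := cumulative_intensity_MVT lam_cont a0 ta.
have := HM c (lt_le_trans Ma ac); rewrite /= ler_distlC => /andP[lamc _].
have {}lamc : m / 2 <= lam c by lra.
have La : 0 <= L a by exact: cumulative_intensity_ge0.
rewrite -(subrK (L a) (L t)) LE.
have : A <= m / 2 * (t - a) by rewrite mulrC -ler_pdivrMr// lerBrDl.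
have : m / 2 * (t - a) <= lam c * (t - a) by rewrite ler_wpM2r// subr_ge0.
by lra.
Unshelve. all: by end_near. Qed.

Lemma cumulative_intensity_ratio_cvg h : 0 <= h ->
  L (t + h) / L t @[t --> +oo] --> (1 : R).
Proof.
move=> h0.
have L0 : \forall t \near +oo, 0 < L t.
  exact: (cvgryPgt _).1 cumulative_intensity_cvgy 0.
have -> : (1 : R) = 1 + m * h * 0 by rewrite mulr0 addr0.
have key : 1 + (L (t + h) - L t) / L t @[t --> +oo] --> 1 + m * h * 0.
  apply: cvgD; first exact: cvg_cst.
  apply: cvgM; first exact: cumulative_intensity_increment_cvg.
  exact: (gtr0_cvgV0 L0).2 cumulative_intensity_cvgy.
apply: cvg_trans key.
apply: near_eq_cvg; near=> t.
have Lt : 0 < L t by near: t.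
by field; rewrite gt_eqF.
Unshelve. all: by end_near. Qed.

(** Squeezed between 1 and the k-th power of L (t + h) / L t: polynomial factors
    of the survival function do not influence its limiting ratios. *)
Lemma exp_trunc_ratio_cvg k h : 0 <= h ->
  exp_trunc k.+1 (L (t + h)) / exp_trunc k.+1 (L t) @[t --> +oo] --> (1 : R).
Proof.
move=> h0.
have pow_cvg : (L (t + h) / L t) ^+ k @[t --> +oo] --> (1 : R).
  have := continuous_cvg _ (@exprn_continuous R k 1)
    (cumulative_intensity_ratio_cvg h0).
  by rewrite expr1n; exact.
apply: squeeze_cvgr (@cvg_cst _ (1 : R) _ _ _) pow_cvg; near=> t.
have t0 : 0 <= t by near: t; apply: nbhs_pinfty_ge; exact: num_real.
have Lt : 0 < L t.
  by near: t; exact: (cvgryPgt _).1 cumulative_intensity_cvgy 0.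
have LL : L t <= L (t + h).
  have th : t <= t + h by rewrite lerDl.
  have [c /[!in_itv]/= /andP[tc _]] := cumulative_intensity_MVT lam_cont t0 th.
  rewrite -subr_ge0 => ->.
  by rewrite mulr_ge0 ?subr_ge0 ?lam_ge0// (le_trans t0).
have Q0 := exp_trunc_gt0 k (ltW Lt).
rewrite ler_pdivlMr// mul1r exp_trunc_le ?(ltW Lt)//= ler_pdivrMr//.
(* Write L (t + h) as c * L t with c the ratio of the two. *)
rewrite -{1}(divfK (lt0r_neq0 Lt) (L (t + h))).
by apply: exp_trunc_scale_le; rewrite ?(ltW Lt)// ler_pdivlMr// mul1r.
Unshelve. all: by end_near. Qed.

Lemma erlang_tail_ratio_cvg k h : 0 <= h ->
  erlang_tail k.+1 (L (t + h)) / erlang_tail k.+1 (L t) @[t --> +oo] -->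
  expR (- (m * h)).
Proof.
move=> h0.
rewrite -[X in _ --> X]mulr1.
have expN_cvg : expR (- (L (t + h) - L t)) @[t --> +oo] --> expR (- (m * h)).
  apply: continuous_cvg; first exact: continuous_expR.
  by apply: cvgN; exact: cumulative_intensity_increment_cvg.
have key : expR (- (L (t + h) - L t)) *
    (exp_trunc k.+1 (L (t + h)) / exp_trunc k.+1 (L t)) @[t --> +oo] -->
    expR (- (m * h)) * 1.
  by apply: cvgM; [exact: expN_cvg|exact: exp_trunc_ratio_cvg].
apply: cvg_trans key.
apply: near_eq_cvg; near=> t.
rewrite /= /erlang_tail opprB expRD !expRN invfM invrK; ring.
Unshelve. all: by end_near. Qed.
End limits.

(** * Limit distribution of the excess *)

Lemma excess_cdf_ccdf (R : realType) d (Om : measurableType d)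
    (P : probability Om R) (T : {RV P >-> R}) t h : 0 <= h ->
  excess_cdf T t h =
  (fine (ccdf T t) - fine (ccdf T (t + h))) / fine (ccdf T t).
Proof.
move=> h0.
rewrite /excess_cdf /cond_prob.
have -> : [set w | t < T w <= t + h] `&` [set w | t < T w] =
  (T @^-1` `]t, +oo[) `\` (T @^-1` `](t + h), +oo[).
  apply/seteqP; split=> w /=; rewrite !in_itv/= !andbT.
    by move=> [/andP[-> wt] _]; split=> //; apply/negP; rewrite -leNgt.
  by move=> [-> /negP]; rewrite -leNgt => ->.
have -> : [set w | t < T w] = T @^-1` `]t, +oo[.
  by apply/seteqP; split=> w /=; rewrite in_itv/= andbT.
have mT s : measurable (T @^-1` `]s, +oo[).
  by rewrite -[_ @^-1` _]setTI; exact: measurable_funPT.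
rewrite measureD// ?ltey_eq ?fin_num_measure//.
rewrite setIidr; last first.
  by move=> w /=; rewrite !in_itv/= !andbT; apply: le_lt_trans; rewrite lerDl.
by rewrite fineB ?fin_num_measure.
Qed.

Lemma is_cdf_exponential (R : realType) (m : R) : 0 < m ->
  is_cdf (fun h : R => if 0 <= h then 1 - expR (- (m * h)) else 0).
Proof.
move=> m0.
have G_ge0 (x : R) : 0 <= x -> 0 <= 1 - expR (- (m * x)).
  by move=> x0; rewrite subr_ge0 expR_le1 oppr_le0 mulr_ge0// ltW.
have G_cont : continuous (fun h : R => 1 - expR (- (m * h))).
  move=> x; apply: cvgB; first exact: cvg_cst.
  apply: continuous_cvg; first exact: continuous_expR.
  by apply: cvgN; apply: cvgMl_tmp.
split.
- move=> x y xy; have [x0|x0] := leP 0 x.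
    by rewrite (le_trans x0 xy) lerB// ler_expR lerN2 ler_pM2l.
  by have [y0|//] := leP 0 y; exact: G_ge0.
- move=> x; have [x0|x0] := leP 0 x.
    apply: cvg_trans (cvg_at_right_filter (G_cont x)).
    apply: near_eq_cvg; near=> y.
    have -> // : 0 <= y.
    by rewrite (le_trans x0)//; near: y; exact: nbhs_right_ge.
  apply: cvg_near_cst; near=> y.
  have y0 : y < 0 by near: y; exact: nbhs_right_lt.
  by rewrite leNgt y0.
- apply: cvg_near_cst; near=> y.
  have y0 : y < 0 by near: y; apply: nbhs_ninfty_lt; exact: num_real.
  by rewrite leNgt y0.
- rewrite -[X in _ --> X]subr0.
  have E : expR (- (m * x)) @[x --> +oo] --> (0 : R).
    have mx : m * x @[x --> +oo] --> +oo by exact: gt0_cvgMry m0 (@cvg_id _ _).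
    exact: cvg_comp mx (@cvgr_expR R).
  have key : 1 - expR (- (m * x)) @[x --> +oo] --> (1 - 0 : R).
    by apply: cvgB; [exact: cvg_cst|exact: E].
  apply: cvg_trans key.
  apply: near_eq_cvg; near=> y.
  have y0 : 0 <= y by near: y; apply: nbhs_pinfty_ge; exact: num_real.
  by rewrite y0.
Unshelve. all: by end_near. Qed.

Theorem theorem3p2 (R : realType) (lam : R -> R) (m : R)
  (lam_cont : {within `[0, +oo[, continuous lam})
  (lam_ge0 : forall t, 0 <= t -> 0 <= lam t)
  (m_gt0 : 0 < m)
  (lam_lim : lam t @[t --> +oo] --> m)
  (k : nat) (k_ge1 : (1 <= k)%N)
  (d : measure_display) (Om : measurableType d) (P : probability Om R)
  (Tk : {RV P >-> R})
  (Tk_pdf : has_pdf Tk (jump_time_pdf lam k)) :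
  is_limit_cdf Tk (fun h => if 0 <= h then 1 - expR (- (m * h)) else 0) /\
  (forall h, 0 <= h ->
     cond_prob P [set w | t < Tk w <= t + h] [set w | t < Tk w]
       @[t --> +oo] --> 1 - expR (- (m * h))).
Proof.
case: k k_ge1 Tk_pdf => // k _ Tk_pdf.
have limE h : 0 <= h -> excess_cdf Tk t h @[t --> +oo] --> 1 - expR (- (m * h)).
  move=> h0.
  pose L := cumulative_intensity lam.
  have key :
      1 - erlang_tail k.+1 (L (t + h)) / erlang_tail k.+1 (L t) @[t --> +oo] -->
      1 - expR (- (m * h)).
    by apply: cvgB; [exact: cvg_cst|exact: erlang_tail_ratio_cvg].
  apply: cvg_trans key.
  apply: near_eq_cvg; near=> t.
  have t0 : 0 <= t by near: t; apply: nbhs_pinfty_ge; exact: num_real.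
  rewrite excess_cdf_ccdf// !(ccdf_jump_time lam_cont Tk_pdf)// ?addr_ge0//=.
  by rewrite mulrBl divff// gt_eqF// erlang_tail_gt0// cumulative_intensity_ge0.
split=> //; split; first exact: is_cdf_exponential.
move=> h; have [h0|h0] := leP 0 h; first exact: limE.
(* For h < 0 the event t < Tk <= t + h is empty. *)
have -> : (excess_cdf Tk)^~ h = cst 0; last exact: cvg_cst.
apply/funext => t; rewrite /excess_cdf /cond_prob.
rewrite (_ : [set w | t < Tk w <= t + h] = set0) ?set0I ?measure0 ?mul0r//.
apply/seteqP; split=> // w /= /andP[tw /(lt_le_trans tw)].
by rewrite ltrDl ltNge (ltW h0).
Unshelve. all: by end_near.
Qed.
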